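(* Let $\mathscr{F}$ be an arbitrary field. If $A \in M_n(\mathscr{F})$ is not square-zero (that is, $A^2 \neq 0$), then $A$ is similar to a matrix of the form \[\begin{bmatrix} \lambda & c^T \\ b & D \end{bmatrix}\] with $\lambda \in \mathscr{F}$, $D \in M_{n-1}(\mathscr{F})$, $b, c \in \mathscr{F}^{n-1}$ column vectors, $\mathrm{r}(D) = \mathrm{r}(A) - 1$, $b \in \mathrm{R}(D)$ and $c \in \mathrm{R}(D^T)$.
   Context: $M_n(\mathscr{F})$ denotes the set of all $n \times n$ matrices over the field $\mathscr{F}$. For a matrix $M$, $\mathrm{r}(M)$ denotes its rank and $\mathrm{R}(M)$ denotes its range (column space). Similarity is over $\mathscr{F}$. *)

(* Defs.v *)
From mathcomp Require Import all_boot all_order all_algebra.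
Set Implicit Arguments.
Unset Strict Implicit.
Unset Printing Implicit Defensive.
Import GRing.Theory.
Local Open Scope ring_scope.

(* Membership of a column vector in the range (column space) of M.
   MathComp's %MS order compares row spaces, hence the transpositions. *)
Definition in_range (F : fieldType) (m n : nat) (M : 'M[F]_(m, n))
  (v : 'cV[F]_m) : bool := (v^T <= M^T)%MS.

Lemma in_rangeP (F : fieldType) (m n : nat) (M : 'M[F]_(m, n)) (v : 'cV[F]_m) :
  reflect (exists w : 'cV[F]_n, v = M *m w) (in_range M v).
Proof.
apply: (iffP submxP) => [[w vE]|[w ->]].
  by exists w^T; apply: trmx_inj; rewrite trmx_mul trmxK.
by exists w^T; rewrite trmx_mul.
Qed.

(* Main.v *)
Require Import Defs.
From mathcomp Require Import all_boot all_order all_algebra.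
Set Implicit Arguments.
Unset Strict Implicit.
Unset Printing Implicit Defensive.
Import GRing.Theory.
Local Open Scope ring_scope.

(** The goal is a splitting of the space as a line <u> plus a hyperplane ker f,
    with f u = 1: the block form is A in an adapted basis, u corresponding to
    the first coordinate vector and f to the first coordinate form.

    The conditions on b, c and D hold as soon as u = A x and f = y A for some
    column x and row y with b0 := y A x nonzero.  Indeed, in adapted
    coordinates, the lower rows of A x = u read b x0 + D x' = 0, and the right
    columns of y A = f read y0 c^T + y' D = 0; since y u = y A x = f x, both x0
    and y0 equal b0, so one can solve for b and c.  The same relations, read as
    row and column operations, turn A into diag(b0, D), whence the rank of D.

    The requirement f u = 1 then becomes y A^2 x = 1.  So what is needed is a
    pair (x, y) at which neither of the bilinear forms y A x and y A^2 x
    vanishes.  Both forms are nonzero because A^2 is, and a vector space over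
    any field, even the one with two elements, is not the union of two proper
    subspaces; applying this once to y and once to x gives the pair, and y can
    be rescaled to make y A^2 x equal to 1. *)

(** A row y killed by N but not by M, and a row z killed by M but not by N, have
    a sum killed by neither: two proper subspaces (here the left kernels) never
    cover the space, whatever the size of the field. *)
Lemma row_nonzero_on_both (F : fieldType) (m p q : nat)
    (M : 'M[F]_(m, p)) (N : 'M[F]_(m, q)) :
  M != 0 -> N != 0 -> exists y : 'rV_m, y *m M != 0 /\ y *m N != 0.
Proof.
have nz r (K : 'M[F]_(m, r)) : K != 0 -> exists y : 'rV_m, y *m K != 0.
  case/rowV0Pn=> v /submxP[w ->] wK0; by exists w.
move=> /nz[y yM] /nz[z zN].
have [yN|yN] := eqVneq (y *m N) 0; last by exists y.
have [zM|zM] := eqVneq (z *m M) 0; last by exists z.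
by exists (y + z); rewrite !mulmxDl yN zM addr0 add0r.
Qed.

(** The rows of P are f followed by a basis of the forms that vanish at u. *)
Lemma adapted_basis (F : fieldType) (n : nat)
    (f : 'rV[F]_(1 + n)) (u : 'cV[F]_(1 + n)) :
  f *m u = 1%:M ->
  exists P : 'M[F]_(1 + n),
    [/\ P \in unitmx, P *m u = col_mx 1%:M 0 & row_mx 1%:M 0 *m P = f].
Proof.
move=> fu.
have rku : \rank u = 1%N.
  apply/eqP; rewrite eqn_leq rank_leq_col /=.
  by rewrite -[X in (X <= _)%N](mxrank1 F 1) -fu mxrankM_maxr.
have rkK : \rank (kermx u) = n by rewrite mxrank_ker rku addKn.
pose N := castmx (rkK, erefl (1 + n)%N) (row_base (kermx u)).
have Nu : N *m u = 0.
  by apply/sub_kermxP; rewrite eqmx_cast eq_row_base.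
have freeN : row_free N by rewrite row_free_castmx row_base_free.
have Pu : col_mx f N *m u = col_mx 1%:M 0 by rewrite mul_col_mx fu Nu.
exists (col_mx f N); split=> //; last first.
  by rewrite mul_row_col mul1mx mul0mx addr0.
rewrite -row_free_unit; apply: inj_row_free => v vP0.
(* Evaluating the relation at u kills the coefficient of f. *)
have v0 : lsubmx v = 0.
  have := congr1 (mulmx^~ u) vP0.
  by rewrite -mulmxA Pu mul0mx -{1}[v]hsubmxK mul_row_col mulmx1 mulmx0 addr0.
move: vP0; rewrite -[v]hsubmxK v0 mul_row_col mul0mx add0r => vN0.
by have /eqP := vN0; rewrite (mulmx_free_eq0 _ freeN) => /eqP ->; rewrite row_mx0.
Qed.

(** Here (1, 0) stands for both u and f in adapted coordinates.  Replacing the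
    first row of B by the combination y of its rows, and the first column by the
    combination x of its columns, clears the b and c blocks and leaves the pivot
    y B x in the corner; as the pivot is nonzero, both replacements are
    invertible. *)
Lemma block_rank_range (F : fieldType) (n : nat) (B : 'M[F]_(1 + n))
    (x : 'cV[F]_(1 + n)) (y : 'rV[F]_(1 + n)) :
  B *m x = col_mx 1%:M 0 -> y *m B = row_mx 1%:M 0 -> y *m B *m x != 0 ->
  [/\ \rank (drsubmx B) = (\rank B - 1)%N,
      in_range (drsubmx B) (dlsubmx B)
    & in_range (drsubmx B)^T (ursubmx B)^T].
Proof.
set l := ulsubmx B; set c := ursubmx B; set b := dlsubmx B; set D := drsubmx B.
set x0 := usubmx x; set x1 := dsubmx x; set y0 := lsubmx y; set y1 := rsubmx y.
have BE : B = block_mx l c b D by rewrite submxK.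
have xE : x = col_mx x0 x1 by rewrite vsubmxK.
have yE : y = row_mx y0 y1 by rewrite hsubmxK.
move=> Bx yB yBx0.
have x0E : x0 = y *m B *m x by rewrite yB xE mul_row_col mul1mx mul0mx addr0.
have y0E : y0 = y *m B *m x.
  by rewrite -mulmxA Bx yE mul_row_col mulmx1 mulmx0 addr0.
pose b0 := (y *m B *m x) 0 0.
have b0E : y *m B *m x = b0%:M by rewrite -mx11_scalar.
have b0nz : b0 != 0.
  by apply: contra_neq yBx0 => e; rewrite b0E e raddf0.
rewrite b0E in x0E y0E.
have bE : b *m b0%:M + D *m x1 = 0.
  by move: Bx; rewrite BE xE x0E mul_block_col => /eq_col_mx[].
have cE : b0%:M *m c + y1 *m D = 0.
  by move: yB; rewrite BE yE y0E mul_row_block => /eq_row_mx[].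
split.
- pose L : 'M_(1 + n) := block_mx b0%:M y1 0 1%:M.
  pose R : 'M_(1 + n) := block_mx b0%:M 0 x1 1%:M.
  have uL : L \in unitmx.
    by rewrite unitmxE det_ublock det1 mulr1 det_scalar unitrX ?unitfE.
  have uR : R \in unitmx.
    by rewrite unitmxE det_lblock det1 mulr1 det_scalar unitrX ?unitfE.
  have LBR : L *m B *m R = block_mx b0%:M 0 0 D.
    move: yB; rewrite BE yE y0E mul_row_block => /eq_row_mx[e1 e2].
    rewrite mulmx_block e1 e2 mulmx_block.
    rewrite !(mul0mx, mulmx0, mul1mx, mulmx1, add0r, addr0).
    by rewrite bE.
  have <- : \rank (L *m B *m R) = \rank B.
    rewrite mxrankMfree ?row_free_unit //.
    by rewrite eqmxMfull ?row_full_unit.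
  by rewrite LBR rank_diag_block_mx -scalemx1 mxrank_scale_nz // mxrank1 addKn.
- apply/in_rangeP; exists (- (b0^-1 *: x1)).
  move/eqP: bE; rewrite addr_eq0 mul_mx_scalar => /eqP bE.
  by rewrite mulmxN -scalemxAr -scalerN -bE scalerA mulVf // scale1r.
- apply/in_rangeP; exists (- (b0^-1 *: y1))^T.
  move/eqP: cE; rewrite addr_eq0 mul_scalar_mx => /eqP cE.
  by rewrite -trmx_mul mulNmx -scalemxAl -scalerN -cE scalerA mulVf // scale1r.
Qed.

Theorem proposition1 (F : fieldType) (n : nat) (A : 'M[F]_n.+1)
    (hA : A ^+ 2 != 0) :
  exists (lambda : F) (b c : 'cV[F]_n) (D : 'M[F]_n),
    [/\ A ~_{in unitmx} (block_mx lambda%:M c^T b D : 'M[F]_(1 + n)),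
        \rank D = (\rank A - 1)%N,
        in_range D b
      & in_range D^T c].
Proof.
have A2nz : A *m A != 0 by [].
have Anz : A != 0 by apply: contra_neq A2nz => ->; rewrite mul0mx.
have [y [yA yA2]] := row_nonzero_on_both Anz A2nz.
have trnz p q (M : 'M[F]_(p, q)) : M != 0 -> M^T != 0 by rewrite trmx_eq0.
have [z [yAz yA2z]] := row_nonzero_on_both (trnz _ _ _ yA) (trnz _ _ _ yA2).
move: yAz yA2z; rewrite -[z]trmxK -!trmx_mul !trmx_eq0; move: z^T => x yAx yA2x.
pose a := (y *m (A *m A) *m x) 0 0.
have aE : y *m (A *m A) *m x = a%:M by rewrite -mx11_scalar.
have anz : a != 0 by apply: contra_neq yA2x => e; rewrite aE e raddf0.
pose y' := a^-1 *: y; pose f := y' *m A; pose u := A *m x.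
have fu : f *m u = 1%:M.
  rewrite /f /u /y' -!scalemxAl mulmxA -(mulmxA y) aE.
  by rewrite scale_scalar_mx mulVf.
have [P [uP Pu fP]] := @adapted_basis F n f u fu.
pose B : 'M[F]_(1 + n) := P *m A *m invmx P.
have [|||rD bD cD] := @block_rank_range F n B (P *m x) (y' *m invmx P).
- by rewrite /B mulmxA mulmxKV // -mulmxA.
- by rewrite /B !mulmxA mulmxKV // -/f -fP mulmxK.
- rewrite /B !mulmxA !mulmxKV // /y' -!scalemxAl scaler_eq0 negb_or invr_eq0.
  by rewrite anz.
exists (ulsubmx B 0 0), (dlsubmx B), (ursubmx B)^T, (drsubmx B); split=> //.
- exists P => //; rewrite trmxK -mx11_scalar submxK.
  exact/simmxRL.
- rewrite rD /B mxrankMfree ?row_free_unit ?unitmx_inv //.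
  by rewrite eqmxMfull ?row_full_unit.
Qed.
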